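(* If $W$ is a Reedy fibrant simplicial space, then $\mathrm{Tw}\,W$ is also Reedy fibrant.
   Context: A space means a simplicial set, and a simplicial space is a functor $X\colon \Delta^{op}\to \mathrm{sSet}$, where $\Delta$ is the simplex category; $X_n$ denotes the space $X([n])$. Write $X_{kl}$ for the set of $l$-simplices of $X_k$. Simplicial spaces are enriched in spaces by $\mathrm{Map}(X,Y)_n=\mathrm{Hom}(X\times\Delta[n],Y)$, with $\Delta[n]$ regarded as a constant simplicial space. $F(n)$ is the simplicial space with $F(n)_{kl}=\mathrm{Hom}_\Delta([k],[n])$ for all $l$, and $\partial F(n)_{kl}=\partial\Delta[n]_k$. A simplicial space $W$ is Reedy fibrant if for all $n\ge0$ the map $\mathrm{Map}(F(n),W)\to\mathrm{Map}(\partial F(n),W)$ is a Kan fibration. Twisted arrow construction: let $Q\colon\Delta\to\Delta$ be the functor $Q([n])=[n]^{op}\star[n]\cong[2n+1]$, $Q(\alpha)=\alpha^{op}\star\alpha$, where $\star$ is the join of posets. The twisted arrow construction $\mathrm{Tw}$ on simplicial spaces is (up to natural isomorphism) the precomposition functor $Q^*$, so $\mathrm{Tw}(W)_n=W_{2n+1}$. *)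

(* Defs.v *)
From mathcomp Require Import all_boot.
From mathcomp Require Import boolp.

Set Implicit Arguments.
Unset Strict Implicit.
Unset Printing Implicit Defensive.

#[local] Obligation Tactic := idtac.

(** The object [[n]] = {0 < ... < n} is represented by [n : nat], with
    underlying ordered set ['I_n.+1]. *)

Record simp (n m : nat) := Simp {
  simp_fun :> 'I_n.+1 -> 'I_m.+1;
  simp_homo : {homo simp_fun : i j / (i <= j)%N} }.

Lemma simp_ext n m (f g : simp n m) : (forall i, f i = g i) -> f = g.
Proof.
case: f g => [f hf] [g hg] /= /funext fg; rewrite -{}fg in hg *.
by rewrite (Prop_irrelevance hf hg).
Qed.

Definition simp_id n : simp n n := @Simp n n id (fun _ _ le_ij => le_ij).

Definition simp_comp n m p (g : simp m p) (f : simp n m) : simp n p :=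
  Simp (fun _ _ le_ij => simp_homo g (simp_homo f le_ij)).

Record deltaFunctor := DeltaFunctor {
  df_obj :> nat -> nat;
  df_map : forall n m, simp n m -> simp (df_obj n) (df_obj m);
  df_id : forall n, df_map (simp_id n) = simp_id (df_obj n);
  df_comp : forall n m p (g : simp m p) (f : simp n m),
    df_map (simp_comp g f) = simp_comp (df_map g) (df_map f) }.

Record sSet := SSet {
  ss_obj :> nat -> Type;
  ss_act : forall n m, simp n m -> ss_obj m -> ss_obj n;
  ss_id : forall n (x : ss_obj n), ss_act (simp_id n) x = x;
  ss_comp : forall n m p (g : simp m p) (f : simp n m) (x : ss_obj p),
    ss_act (simp_comp g f) x = ss_act f (ss_act g x) }.

Record sMap (X Y : sSet) := SMap {
  sm_fun :> forall n, X n -> Y n;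
  sm_nat : forall n m (f : simp n m) (x : X m),
    sm_fun (ss_act f x) = ss_act f (sm_fun x) }.

Lemma sMap_ext X Y (f g : sMap X Y) : (forall n x, f n x = g n x) -> f = g.
Proof.
case: f g => [f hf] [g hg] /= fg.
have {}fg : f = g.
  by apply: functional_extensionality_dep => n; apply: funext; apply: fg.
by rewrite -{}fg in hg *; rewrite (Prop_irrelevance hf hg).
Qed.

Definition sMap_id X : sMap X X :=
  @SMap X X (fun _ x => x) (fun _ _ _ _ => erefl).

Program Definition sMap_comp X Y Z (g : sMap Y Z) (f : sMap X Y) : sMap X Z :=
  @SMap X Z (fun n x => g n (f n x)) _.
Next Obligation. by move=> X Y Z g f n m a x /=; rewrite !sm_nat. Qed.

Program Definition sProd (X Y : sSet) : sSet :=
  @SSet (fun n => (X n * Y n)%type)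
    (fun n m a xy => (ss_act a xy.1, ss_act a xy.2)) _ _.
Next Obligation. by move=> X Y n [x y] /=; rewrite !ss_id. Qed.
Next Obligation. by move=> X Y n m p g f [x y] /=; rewrite !ss_comp. Qed.

Program Definition sSub (X : sSet) (P : forall n, X n -> Prop)
    (PS : forall n m (a : simp n m) x, P m x -> P n (ss_act a x)) : sSet :=
  @SSet (fun n => {x : X n | P n x})
    (fun n m a x => exist _ (ss_act a (proj1_sig x)) (PS _ _ a _ (proj2_sig x)))
    _ _.
Next Obligation. by move=> X P PS n [x px]; apply: eq_exist; apply: ss_id. Qed.
Next Obligation.
by move=> X P PS n m p g f [x px]; apply: eq_exist; apply: ss_comp.
Qed.

Definition sSub_incl X P PS : sMap (@sSub X P PS) X :=
  @SMap (sSub PS) X (fun _ x => proj1_sig x) (fun _ _ _ _ => erefl).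

Program Definition Delta (n : nat) : sSet :=
  @SSet (fun k => simp k n) (fun k l a x => simp_comp x a) _ _.
Next Obligation. by move=> n k x; apply: simp_ext. Qed.
Next Obligation. by move=> n k l p g f x; apply: simp_ext. Qed.

Program Definition Delta_map n m (a : simp n m) : sMap (Delta n) (Delta m) :=
  @SMap (Delta n) (Delta m) (fun k x => simp_comp a x) _.
Next Obligation. by move=> n m a k l f x; apply: simp_ext. Qed.

(** A simplex [x : [k] -> [n]] lies in the face opposite to the vertex [j]
    iff [x] misses [j]. *)
Definition misses k n (x : simp k n) (j : 'I_n.+1) : Prop :=
  forall i, x i <> j.

Definition in_boundary n k (x : Delta n k) : Prop := exists j, misses x j.

Definition in_horn n (h : 'I_n.+1) k (x : Delta n k) : Prop :=
  exists2 j, j <> h & misses x j.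

Lemma in_boundary_act n k l (a : simp k l) (x : Delta n l) :
  in_boundary x -> in_boundary (ss_act a x).
Proof. by case=> j xj; exists j => i; apply: xj. Qed.

Lemma in_horn_act n (h : 'I_n.+1) k l (a : simp k l) (x : Delta n l) :
  in_horn h x -> in_horn h (ss_act a x).
Proof. by case=> j jh xj; exists j => // i; apply: xj. Qed.

Definition bDelta n : sSet := sSub (@in_boundary_act n).
Definition bDelta_incl n : sMap (bDelta n) (Delta n) := sSub_incl _.

Definition horn n (h : 'I_n.+1) : sSet := sSub (@in_horn_act n h).
Definition horn_incl n (h : 'I_n.+1) : sMap (horn h) (Delta n) := sSub_incl _.

Definition rlp A B (i : sMap A B) X Y (p : sMap X Y) : Prop :=
  forall (u : sMap A X) (v : sMap B Y), sMap_comp p u = sMap_comp v i ->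
    exists w : sMap B X, sMap_comp w i = u /\ sMap_comp p w = v.

(** Horns are only considered in positive dimension [n.+1]. *)
Definition kan_fibration X Y (p : sMap X Y) : Prop :=
  forall n (h : 'I_n.+2), rlp (horn_incl h) p.

(** [X n : sSet] is the space X_n; the set X_{kl} is [X k l].  The functor
    laws are stated pointwise, which by [sMap_ext] is equality of maps. *)
Record sSpace := SSpace {
  sp_obj :> nat -> sSet;
  sp_act : forall n m, simp n m -> sMap (sp_obj m) (sp_obj n);
  sp_id : forall n l (x : sp_obj n l), sp_act (simp_id n) l x = x;
  sp_comp : forall n m p (g : simp m p) (f : simp n m) l (x : sp_obj p l),
    sp_act (simp_comp g f) l x = sp_act f l (sp_act g l x) }.

Arguments sp_act {s n m}.

Record spMap (X Y : sSpace) := SpMap {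
  spm_fun :> forall n, sMap (X n) (Y n);
  spm_nat : forall n m (f : simp n m) l (x : X m l),
    spm_fun n l (sp_act f l x) = sp_act f l (spm_fun m l x) }.

Lemma spMap_ext X Y (f g : spMap X Y) :
  (forall n l x, f n l x = g n l x) -> f = g.
Proof.
case: f g => [f hf] [g hg] /= fg.
have {}fg : f = g.
  by apply: functional_extensionality_dep => n; apply: sMap_ext; apply: fg.
by rewrite -{}fg in hg *; rewrite (Prop_irrelevance hf hg).
Qed.

Program Definition spMap_comp X Y Z (g : spMap Y Z) (f : spMap X Y) :
  spMap X Z := @SpMap X Z (fun n => sMap_comp (g n) (f n)) _.
Next Obligation. by move=> X Y Z g f n m a l x /=; rewrite !spm_nat. Qed.

(** A space [K] as a simplicial space constant in the first direction:
    K_{kl} = K_l. *)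
Definition spConst (K : sSet) : sSpace :=
  @SSpace (fun _ => K) (fun _ _ _ => sMap_id K)
    (fun _ _ _ => erefl) (fun _ _ _ _ _ _ _ => erefl).

Definition spConst_map K L (f : sMap K L) : spMap (spConst K) (spConst L) :=
  @SpMap (spConst K) (spConst L) (fun _ => f) (fun _ _ _ _ _ => erefl).

Definition sDiscrete (S : Type) : sSet :=
  @SSet (fun _ => S) (fun _ _ _ x => x)
    (fun _ _ => erefl) (fun _ _ _ _ _ _ => erefl).

(** A simplicial set [K] as a levelwise discrete simplicial space:
    K_{kl} = K_k. *)
Definition spDisc (K : sSet) : sSpace :=
  @SSpace (fun k => sDiscrete (K k))
    (fun n m a => @SMap (sDiscrete (K m)) (sDiscrete (K n))
                    (fun _ => ss_act a) (fun _ _ _ _ => erefl))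
    (fun n _ => @ss_id K n) (fun n m p g f _ => @ss_comp K n m p g f).

Definition spDisc_map K L (f : sMap K L) : spMap (spDisc K) (spDisc L) :=
  @SpMap (spDisc K) (spDisc L)
    (fun k => @SMap (sDiscrete (K k)) (sDiscrete (L k))
                (fun _ => f k) (fun _ _ _ _ => erefl))
    (fun n m a _ => @sm_nat K L f n m a).

Program Definition sProd_map X X' Y Y' (f : sMap X X') (g : sMap Y Y') :
    sMap (sProd X Y) (sProd X' Y') :=
  @SMap (sProd X Y) (sProd X' Y') (fun n xy => (f n xy.1, g n xy.2)) _.
Next Obligation. by move=> X X' Y Y' f g n m a x /=; rewrite !sm_nat. Qed.

Program Definition spProd (X Y : sSpace) : sSpace :=
  @SSpace (fun n => sProd (X n) (Y n))
    (fun n m a => sProd_map (sp_act a) (sp_act a)) _ _.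
Next Obligation. by move=> X Y n l [x y] /=; rewrite !sp_id. Qed.
Next Obligation. by move=> X Y n m p g f l [x y] /=; rewrite !sp_comp. Qed.

Program Definition spProd_map X X' Y Y' (f : spMap X X') (g : spMap Y Y') :
    spMap (spProd X Y) (spProd X' Y') :=
  @SpMap (spProd X Y) (spProd X' Y') (fun n => sProd_map (f n) (g n)) _.
Next Obligation. by move=> X X' Y Y' f g n m a l x /=; rewrite !spm_nat. Qed.

Definition spMap_id X : spMap X X :=
  @SpMap X X (fun n => sMap_id (X n)) (fun _ _ _ _ _ => erefl).

Program Definition Map (X Y : sSpace) : sSet :=
  @SSet (fun n => spMap (spProd X (spConst (Delta n))) Y)
    (fun n m a f =>
       spMap_comp f (spProd_map (spMap_id X) (spConst_map (Delta_map a)))) _ _.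
Next Obligation.
move=> X Y n f; apply: spMap_ext => k l [x d] /=; congr (f k l (_, _)).
exact: simp_ext.
Qed.
Next Obligation.
move=> X Y n m p g a f; apply: spMap_ext => k l [x d] /=.
by congr (f k l (_, _)); apply: simp_ext.
Qed.

Program Definition Map_pre A B (i : spMap A B) (Y : sSpace) :
    sMap (Map B Y) (Map A Y) :=
  @SMap (Map B Y) (Map A Y)
    (fun n f => spMap_comp f (spProd_map i (spMap_id (spConst (Delta n))))) _.
Next Obligation. by move=> A B i Y n m a f; apply: spMap_ext. Qed.

Definition F (n : nat) : sSpace := spDisc (Delta n).
Definition bF (n : nat) : sSpace := spDisc (bDelta n).
Definition bF_incl n : spMap (bF n) (F n) := spDisc_map (bDelta_incl n).

Definition reedy_fibrant (W : sSpace) : Prop :=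
  forall n : nat, kan_fibration (Map_pre (bF_incl n) W).

Program Definition precomp (G : deltaFunctor) (W : sSpace) : sSpace :=
  @SSpace (fun n => W (G n)) (fun n m a => sp_act (df_map G a)) _ _.
Next Obligation. by move=> G W n l x /=; rewrite df_id sp_id. Qed.
Next Obligation. by move=> G W n m p g f l x /=; rewrite df_comp sp_comp. Qed.

(** The poset [[n]]^op is identified with [[n]] through the order
    isomorphism [rev_ord]. *)
Program Definition simp_op n m (f : simp n m) : simp n m :=
  @Simp n m (fun i => rev_ord (f (rev_ord i))) _.
Next Obligation.
move=> n m f i j le_ij /=; rewrite leq_sub2l // ltnS; apply: simp_homo.
by rewrite /= leq_sub2l.
Qed.

(** The join of [[n]] and [[p]] is [[n + p.+1]], whose underlying set ['I_(n + p.+1).+1] is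
    convertible to ['I_(n.+1 + p.+1)]: first a copy of [[n]], then a copy of
    [[p]]. *)
Definition join_fun n m p q (f : simp n m) (g : simp p q)
    (i : 'I_(n.+1 + p.+1)) : 'I_(m.+1 + q.+1) :=
  match split i with
  | inl j => lshift q.+1 (f j)
  | inr j => rshift m.+1 (g j)
  end.

Program Definition simp_join n m p q (f : simp n m) (g : simp p q) :
    simp (n + p.+1) (m + q.+1) :=
  @Simp (n + p.+1) (m + q.+1) (join_fun f g) _.
Next Obligation.
move=> n m p q f g i j le_ij; rewrite /join_fun.
case: (@splitP n.+1 p.+1 i) => i' ii'; case: (@splitP n.+1 p.+1 j) => j' jj' /=.
- by apply: simp_homo; rewrite -ii' -jj'.
- by apply: leq_trans (leq_addr _ _); apply: ltnW.
- by move: le_ij; rewrite ii' jj' leqNgt (leq_trans (ltn_ord j')) // leq_addr.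
- by rewrite leq_add2l simp_homo // -(leq_add2l n.+1) -ii' -jj'.
Qed.

(** Q([[n]]) is the join of [[n]]^op and [[n]], i.e. [[2n+1]]; see [Q_objE]. *)
Program Definition Q : deltaFunctor :=
  @DeltaFunctor (fun n => n + n.+1) (fun n m a => simp_join (simp_op a) a) _ _.
Next Obligation.
move=> n; apply: simp_ext => i; apply: val_inj; rewrite /= /join_fun.
case: (@splitP n.+1 n.+1 i) => j -> //=.
exact: (congr1 val (rev_ordK j)).
Qed.
Next Obligation.
move=> n m p g f; apply: simp_ext => i; rewrite /= /join_fun.
case: (@splitP n.+1 n.+1 i) => j _.
  have -> : split (lshift m.+1 (simp_op f j)) = inl (simp_op f j).
    exact: (@unsplitK m.+1 m.+1 (inl _)).
  by rewrite /= rev_ordK.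
have -> // : split (rshift m.+1 (f j)) = inr (f j).
exact: (@unsplitK m.+1 m.+1 (inr _)).
Qed.

Lemma Q_objE n : Q n = n.*2.+1.
Proof. by rewrite /= addnS addnn. Qed.

Definition Tw (W : sSpace) : sSpace := precomp Q W.

(* Main.v *)
From mathcomp Require Import all_boot.
From mathcomp Require Import boolp.
Require Import Defs.

(** A lifting problem of a horn inclusion [i] against
    Map(F(n), Tw W) -> Map(bF(n), Tw W) is, by adjunction, an extension problem
    along the pushout-product of [i] with bF(n) -> F(n), for maps into Tw W
    ([rlp_Map_pre]).  Since Tw is precomposition with Q, it has a left adjoint
    taking F(n) to F(Q n), and bF(n) to the subcomplex of F(Q n) generated by
    the [Q e] with [e] in the boundary of the standard simplex ([Tw_boundary]).
    So the problem becomes one for maps into W, along the pushout-product of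
    [i] with the inclusion of a subcomplex of F(Q n).  Such an inclusion is a
    finite composite of attachments of cells along bF(p) -> F(p), and W has the
    extension property for each of these by Reedy fibrancy ([pp_ext_sub]).

    The left adjoint of Tw is not constructed; what is needed is that a map
    [g] out of bF(n) x B into Tw W extends to the subcomplex [Tw_boundary].
    A simplex [x] of that subcomplex satisfies [Q e x = x] for an endomorphism
    [e] of the object n lying in the boundary, so the value at [(x, b)] has to
    be the restriction along [x] of [g (e, b)].  It does not depend on [e]
    ([Tw_value_uniq]): if [r] is an order-preserving retraction onto the
    vertices of n over which [x] has a vertex, then [Q r x = x] and [e r = r],
    so [e] may be replaced by [r]. *)

Set Implicit Arguments.
Unset Strict Implicit.
Unset Printing Implicit Defensive.

#[local] Obligation Tactic := idtac.

(** * Extension along pushout-products *)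

Lemma sSub_ext X P PS n (x y : @sSub X P PS n) : proj1_sig x = proj1_sig y -> x = y.
Proof. by case: x y => [x px] [y py] /= xy; apply: eq_exist. Qed.

(** Extension of maps into [W] along the pushout-product of [i] and [j]; a map
    out of the pushout is given as a compatible pair. *)
Definition pp_ext A B (i : sMap A B) X Y (j : spMap X Y) (W : sSpace) : Prop :=
  forall (f : spMap (spProd Y (spConst A)) W)
         (g : spMap (spProd X (spConst B)) W),
    (forall k l (x : X k l) (a : A l),
       f k l (j k l x, a) = g k l (x, i l a)) ->
  exists w : spMap (spProd Y (spConst B)) W,
    (forall k l (y : Y k l) (a : A l), w k l (y, i l a) = f k l (y, a)) /\
    (forall k l (x : X k l) (b : B l), w k l (j k l x, b) = g k l (x, b)).

Lemma spMap_natl X Y (f : spMap X Y) k n m (a : simp n m) (x : X k m) :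
  f k n (ss_act a x) = ss_act a (f k m x).
Proof. exact: sm_nat. Qed.

Program Definition curry K X Y (g : spMap (spProd X (spConst K)) Y) :
    sMap K (Map X Y) :=
  @SMap K (Map X Y) (fun n c =>
    @SpMap (spProd X (spConst (Delta n))) Y
      (fun k => @SMap (spProd X (spConst (Delta n)) k) (Y k)
         (fun l xa => g k l (xa.1, ss_act xa.2 c)) _) _) _.
Next Obligation.
by move=> K X Y g n c k l m a [x d] /=; rewrite -(spMap_natl g) /= ss_comp.
Qed.
Next Obligation. by move=> K X Y g n c k m a l [x d] /=; rewrite -(spm_nat g). Qed.
Next Obligation.
by move=> K X Y g n m a c; apply: spMap_ext => k l [x d] /=; rewrite ss_comp.
Qed.

Program Definition uncurry K X Y (u : sMap K (Map X Y)) :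
    spMap (spProd X (spConst K)) Y :=
  @SpMap (spProd X (spConst K)) Y
    (fun k => @SMap (spProd X (spConst K) k) (Y k)
       (fun l xc => u l xc.2 k l (xc.1, simp_id l)) _) _.
Next Obligation.
move=> K X Y u k n m a [x c] /=; rewrite sm_nat /= -(spMap_natl (u m c)) /=.
by congr (u m c k n (_, _)); apply: simp_ext.
Qed.
Next Obligation. by move=> K X Y u n m a l [x c] /=; rewrite -(spm_nat (u l c)). Qed.

Lemma curryK K X Y (u : sMap K (Map X Y)) n c k l x d :
  curry (uncurry u) n c k l (x, d) = u n c k l (x, d).
Proof.
rewrite /= sm_nat /=; congr (u n c k l (_, _)); exact: simp_ext.
Qed.

(** Transposing both maps of a lifting problem and its filler along the
    adjunction between [spProd X (spConst _)] and [Map X _]. *)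
Lemma rlp_Map_pre A B (i : sMap A B) X Y (j : spMap X Y) W :
  rlp i (Map_pre j W) <-> pp_ext i j W.
Proof.
split=> [lift f g fg|ext u v uv].
- have [|w [wf wg]] := lift (curry f) (curry g).
    apply: sMap_ext => n c; apply: spMap_ext => k l [x d] /=.
    by rewrite fg /= sm_nat.
  exists (uncurry w); split=> k l z c /=.
    have /= -> := congr1 (fun h : sMap _ (Map _ W) => h l c k l (z, simp_id l)) wf.
    by rewrite ss_id.
  have /= -> := congr1 (fun h : sMap _ (Map _ W) => h l c k l (z, simp_id l)) wg.
  by rewrite ss_id.
- have [|w [wf wg]] := ext (uncurry u) (uncurry v).
    move=> k l x a.
    by have /= := congr1 (fun h : sMap _ (Map _ W) => h l a k l (x, simp_id l)) uv.
  exists (curry w); split; apply: sMap_ext => n c; apply: spMap_ext => k l [x d].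
    by rewrite -[RHS]curryK /= -sm_nat wf.
  by rewrite -[RHS]curryK /= wg.
Qed.

(** * The floor of a monotone map *)

Program Definition face p (j : 'I_p.+2) : simp p p.+1 := @Simp p p.+1 (lift j) _.
Next Obligation. by move=> p j i i'; rewrite /= leq_bump2. Qed.

Lemma boundary_factor p (j : 'I_p.+2) k (x : simp k p.+1) :
  misses x j -> exists x' : simp k p, x = simp_comp (face j) x'.
Proof.
move=> xj.
have lt_x i : unbump j (x i) < p.+1.
  have /unlift_some [v xv _] : j != x i by rewrite eq_sym; apply/eqP/xj.
  by rewrite xv /= bumpK.
have x_homo : {homo (fun i => Ordinal (lt_x i)) : i i' / i <= i'}.
  move=> i i' le_ii' /=; rewrite -leq_bump unbumpK ?simp_homo //.
  by rewrite inE; apply/eqP => /val_inj; apply: xj.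
exists (Simp x_homo); apply: simp_ext => i; apply: val_inj => /=.
by rewrite unbumpK // inE; apply/eqP => /val_inj; apply: xj.
Qed.

Fact floor_subproof p N (s : simp p N) (v : 'I_N.+1) :
  \max_(i < p.+1 | s i <= v) i < p.+1.
Proof. by rewrite ltnS; apply/bigmax_leqP => i _; rewrite -ltnS. Qed.

(** When no [i] satisfies [s i <= v], the empty maximum gives 0, which keeps
    the map monotone. *)
Program Definition floor p N (s : simp p N) : simp N p :=
  @Simp N p (fun v => Ordinal (floor_subproof s v)) _.
Next Obligation.
move=> p N s v v' le_vv' /=; apply/bigmax_leqP => i si.
by apply: leq_bigmax_cond; apply: leq_trans le_vv'.
Qed.

(** On the image of [s], the floor picks a preimage, even when [s] is not
    injective. *)
Lemma floorK p N (s : simp p N) i : s (floor s (s i)) = s i.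
Proof.
apply: val_inj; apply/eqP; rewrite eqn_leq; apply/andP; split; last first.
  by apply: simp_homo; apply: (@leq_bigmax_cond _ _ _ i).
rewrite /=.
have [|j sj jmax] := @eq_bigmax_cond _ (fun j : 'I_p.+1 => s j <= s i) (@nat_of_ord _).
  by apply/card_gt0P; exists i; apply: leqnn.
rewrite (_ : Ordinal _ = j) //; exact: val_inj.
Qed.

Lemma floor_section k p (z : simp k p) :
  ~ in_boundary (z : Delta p k) -> simp_comp z (floor z) = simp_id p.
Proof.
move=> zb; apply: simp_ext => j; have [i <-] : exists i, z i = j.
  by apply: contrapT => zj; apply: zb; exists j => i ij; apply: zj; exists i.
exact: floorK.
Qed.

(** * Attaching a cell to a subcomplex of a simplex *)

(** A simplex of the boundary factors through a face, hence through dimension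
    less than [p]. *)
Lemma boundary_faces N p (s : simp p N) (K : forall k, Delta N k -> Prop) :
    (forall k l (a : simp k l) x, K l x -> K k (ss_act a x)) ->
    (forall q, q < p -> forall x : Delta N q, K q x) ->
  forall k (x : Delta p k), in_boundary x -> K k (simp_comp s x).
Proof.
case: p s => [|p] s KS Kp k x [j xj].
  by case: (xj ord0); rewrite (ord1 j) (ord1 (x ord0)).
have [x' ->] := boundary_factor xj.
have -> : simp_comp s (simp_comp (face j) x')
          = ss_act x' (simp_comp s (face j) : Delta N p) by apply: simp_ext.
by apply: KS; apply: Kp.
Qed.

(** [s] is a simplex outside the subcomplex [P] whose boundary lies in [P], so
    that [attach] is the pushout of [P] and the standard p-simplex along the
    boundary. *)
Section Attach.

Variables (N p : nat) (s : simp p N) (P : forall k, Delta N k -> Prop).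
Hypothesis PS : forall k l (a : simp k l) x, P x -> P (ss_act a x).
Hypothesis Ps : ~ @P p s.
Hypothesis Pbs : forall k (x : Delta p k), in_boundary x -> P (simp_comp s x).

(** The idempotent [floor s s] satisfies [s (floor s s) = s]; as [s] is not in
    [P], this idempotent is not in the boundary, so it is surjective and
    therefore the identity. *)
Lemma floorKl : simp_comp (floor s) s = simp_id p.
Proof.
set e := simp_comp _ s.
have es : simp_comp s e = s by apply: simp_ext => i; rewrite /= floorK.
have /floor_section eK : ~ in_boundary (e : Delta p p).
  by move=> eb; apply: Ps; rewrite -es; apply: Pbs.
have ee : simp_comp e e = e by apply: simp_ext => i; rewrite /= floorK.
apply: simp_ext => i.
have ei : e (floor e i) = i by rewrite -[LHS]/(simp_comp e (floor e) i) eK.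
by rewrite -[in LHS]ei -[LHS]/(simp_comp e e (floor e i)) ee ei.
Qed.

Definition attach k (x : Delta N k) : Prop :=
  P x \/ exists z : Delta p k, x = simp_comp s z.

Lemma attach_act k l (a : simp k l) (x : Delta N l) :
  attach x -> attach (ss_act a x).
Proof.
case=> [Px|[z ->]]; first by left; apply: PS.
by right; exists (ss_act a z); apply: simp_ext.
Qed.

Lemma floor_comp k (z : simp k p) : simp_comp (floor s) (simp_comp s z) = z.
Proof.
apply: simp_ext => i.
by rewrite -[LHS]/(simp_comp (floor s) s (z i)) floorKl.
Qed.

(** The characteristic map [s] meets [P] in the boundary only: the simplices of
    the standard p-simplex outside the boundary have sections, by which [s]
    itself is recovered. *)
Lemma attach_boundary k (z : simp k p) :
  P (simp_comp s z : Delta N k) -> @in_boundary p k z.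
Proof.
move=> Pz; apply: contrapT => /floor_section zK; apply: Ps.
have -> : s = ss_act (floor z) (simp_comp s z : Delta N k).
  by apply: simp_ext => i; rewrite -[RHS]/(s (simp_comp z (floor z) i)) zK.
exact: PS.
Qed.

Program Definition attaching_map : sMap (bDelta p) (sSub PS) :=
  @SMap (bDelta p) (sSub PS)
    (fun k x => exist _ (simp_comp s (proj1_sig x)) (Pbs (proj2_sig x))) _.
Next Obligation. by move=> k l a x; apply: sSub_ext; apply: simp_ext. Qed.

Section Glue.

Variables (B : sSet) (W : sSpace).
Variable g : spMap (spProd (spDisc (sSub PS)) (spConst B)) W.
Variable w : spMap (spProd (F p) (spConst B)) W.
Hypothesis wg : forall k l (x : bDelta p k) (b : B l),
  w k l (proj1_sig x : F p k l, b) = g k l (attaching_map k x, b).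

(** A simplex [s z] has the coordinate [z = floor s (s z)] in the new cell. *)
Definition glue_fun k l (x : Delta N k) (b : B l) : W k l :=
  match pselect (P x) with
  | left Px => g k l (exist _ x Px, b)
  | right _ => w k l (simp_comp (floor s) x : F p k l, b)
  end.

Lemma glue_old k l (x : sSub PS k) (b : B l) :
  glue_fun (proj1_sig x) b = g k l (x, b).
Proof.
case: x => x px; rewrite /glue_fun /=; case: pselect => [px'|//].
by rewrite (Prop_irrelevance px' px).
Qed.

Lemma glue_new k l (z : Delta p k) (b : B l) :
  glue_fun (simp_comp s z : Delta N k) b = w k l (z : F p k l, b).
Proof.
rewrite /glue_fun; case: pselect => [Pz|_]; last by rewrite floor_comp.
rewrite (wg (exist _ z (attach_boundary Pz)) b).
by congr (g k l (_, b)); apply: sSub_ext.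
Qed.

Program Definition glue : spMap (spProd (spDisc (sSub attach_act)) (spConst B)) W :=
  @SpMap (spProd (spDisc (sSub attach_act)) (spConst B)) W
    (fun k => @SMap (spProd (spDisc (sSub attach_act)) (spConst B) k) (W k)
                (fun l xb => glue_fun (proj1_sig xb.1) xb.2) _) _.
Next Obligation.
move=> k l m a [[x [Px|[z xz]]] b] /=.
  by rewrite !(glue_old (exist _ x Px)) -(spMap_natl g).
by rewrite xz !glue_new -(spMap_natl w).
Qed.
Next Obligation.
move=> k m a l [[x [Px|[z xz]]] b] /=.
  rewrite (glue_old (exist _ x Px)) -(spm_nat g) -glue_old; congr glue_fun.
have -> : simp_comp x a = simp_comp s (simp_comp z a).
  by rewrite xz; apply: simp_ext.
by rewrite xz !glue_new -(spm_nat w).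
Qed.

End Glue.

End Attach.

(** * Extension along subcomplexes of a simplex *)

Section Subcomplex.

Variables (A B : sSet) (i : sMap A B) (W : sSpace).
Hypothesis ext_bF : forall p, pp_ext i (bF_incl p) W.

Section Step.

Variables (N p : nat) (s : simp p N) (P : forall k, Delta N k -> Prop).
Hypothesis PS : forall k l (a : simp k l) x, P x -> P (ss_act a x).
Hypothesis Ps : ~ @P p s.
Hypothesis Pbs : forall k (x : Delta p k), in_boundary x -> P (simp_comp s x).

(** Fill the cell first, then extend from the enlarged subcomplex. *)
Lemma pp_ext_attach :
  pp_ext i (spDisc_map (sSub_incl (attach_act (s := s) PS))) W ->
  pp_ext i (spDisc_map (sSub_incl PS)) W.
Proof.
move=> ext f g fg.
have [|w [wf wg]] := @ext_bF p
    (spMap_comp f (spProd_map (spDisc_map (Delta_map s)) (spMap_id (spConst A))))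
    (spMap_comp g (spProd_map (spDisc_map (attaching_map PS Pbs))
                              (spMap_id (spConst B)))).
  by move=> k l x a; apply: (fg k l (attaching_map PS Pbs k x) a).
have [|v [vf vg]] := ext f (glue Ps wg).
  move=> k l [x [Px|[z xz]]] a /=.
    by rewrite (glue_old s g w (exist _ x Px)) -fg.
  by subst x; rewrite (glue_new Ps wg) wf.
exists v; split=> // k l [x Px] b.
rewrite -(glue_old s g w) /=.
exact: (vg k l (exist _ x (or_introl Px)) b).
Qed.

End Step.

(** Each attachment removes the image of the new cell from this finite set of
    vertex sets, so its cardinal decreases. *)
Definition missing_images N (P : forall k, Delta N k -> Prop) : {set {set 'I_N.+1}} :=
  [set T | `[< exists k (x : Delta N k), ~ P k x /\ T = [set x j | j : 'I_k.+1] >]].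

(** A missing simplex [s] of least dimension has its boundary in [P], so it can
    be attached as a cell. *)
Lemma pp_ext_sub N (P : forall k, Delta N k -> Prop)
    (PS : forall k l (a : simp k l) x, P l x -> P k (ss_act a x)) :
  pp_ext i (spDisc_map (sSub_incl PS)) W.
Proof.
have [c] := ubnP #|missing_images P|; elim: c => // c IH in P PS *.
rewrite ltnS => le_c.
have [allP|/existsNP[p0 /existsNP[x0 Px0]]] := pselect (forall k x, P k x).
  (* Nothing is missing, so the inclusion of [P] is an isomorphism. *)
  move=> f g fg.
  pose e k (x : Delta N k) : sSub PS k := exist _ x (allP k x).
  have eS k l (a : simp k l) x : e k (ss_act a x) = ss_act a (e l x).
    exact: sSub_ext.
  pose E : sMap (Delta N) (sSub PS) := SMap eS.
  exists (spMap_comp g (spProd_map (spDisc_map E) (spMap_id (spConst B)))).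
  split=> k l x b /=; first by rewrite -fg.
  by congr (g k l (_, b)); apply: sSub_ext.
have ex : exists p, `[< exists s : Delta N p, ~ P p s >].
  by exists p0; apply/asboolP; exists x0.
have [p /asboolP[s Ps] pmin] := ex_minnP ex.
have Pbs : forall k (x : Delta p k), in_boundary x -> P k (simp_comp s x).
  apply: boundary_faces => // q lt_qp x; apply: contrapT => Px.
  by move: lt_qp; rewrite ltnNge pmin //; apply/asboolP; exists x.
apply: (pp_ext_attach Ps Pbs); apply: IH; apply: leq_trans le_c.
apply: proper_card; apply/properP; split.
  apply/subsetP => T; rewrite !inE => /asboolP[k [x [Px ->]]].
  by apply/asboolP; exists k, x; split=> // Px'; apply: Px; left.
exists [set s j | j : 'I_p.+1].
  by rewrite inE; apply/asboolP; exists p, s.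
rewrite inE; apply/asboolP => -[k [x [Px xs]]]; apply: Px; right.
exists (simp_comp (floor s) x); apply: simp_ext => j /=.
have /imsetP[j' _ ->] : x j \in [set s j | j : 'I_p.+1].
  by rewrite xs imset_f.
by rewrite floorK.
Qed.

End Subcomplex.

(** * Retractions of finite ordinals *)

Lemma retraction n (S : {set 'I_n.+1}) : S != set0 ->
  exists r : simp n n, (forall v, r v \in S) /\ (forall v, v \in S -> r v = v).
Proof.
case/set0Pn => v0 Sv0.
case: (@arg_minnP _ v0 (fun j => j \in S) (@nat_of_ord _) Sv0) => m Sm mmin.
(* The largest element of [S] below [v], or [min S] if there is none. *)
pose h (v : 'I_n.+1) := [arg max_(j > m | (j \in S) && (j <= maxn v m)) (j : nat)].
have Pm v : (m \in S) && (m <= maxn v m) by rewrite Sm leq_maxr.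
have hP v : (h v \in S) && (h v <= maxn v m).
  by rewrite /h; case: arg_maxnP => [|j]; first exact: Pm.
have hmax (v j : 'I_n.+1) : j \in S -> j <= maxn v m -> j <= h v.
  move=> Sj jv; rewrite /h; case: arg_maxnP => [|j' _]; first exact: Pm.
  by apply; rewrite Sj.
have h_homo : {homo h : v v' / v <= v'}.
  move=> v v' vv'; have /andP[Sh hv] := hP v; apply: hmax => //.
  by rewrite (leq_trans hv) // geq_max leq_max vv' /= leq_maxr.
exists (Simp h_homo); split=> v /=; first by have /andP[] := hP v.
move=> Sv; apply: val_inj; apply/eqP; rewrite eqn_leq.
have /andP[_] := hP v; rewrite (maxn_idPl (mmin _ Sv)) => -> /=.
by rewrite hmax // leq_maxl.
Qed.

Lemma retraction_onto k n (q : 'I_k.+1 -> 'I_n.+1) :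
  exists r : simp n n, (forall v, exists t, r v = q t) /\ (forall t, r (q t) = q t).
Proof.
have [|r [rS rid]] := @retraction n [set q t | t : 'I_k.+1].
  by apply/set0Pn; exists (q ord0); rewrite imset_f.
exists r; split=> [v|t]; last by rewrite rid ?imset_f.
by have /imsetP[t _ ->] := rS v; exists t.
Qed.

(** * The subcomplex of a simplex corresponding to the boundary under Q *)

(** The two copies of [j], in the dual ordinal and in the ordinal itself, have
    level [j]; all maps [Q e] respect levels. *)
Definition Q_level n (v : 'I_(Q n).+1) : 'I_n.+1 :=
  match @split n.+1 n.+1 v with inl j => rev_ord j | inr j => j end.

Lemma Q_level_map n m (e : simp n m) (v : 'I_(Q n).+1) :
  Q_level (df_map Q e v) = e (Q_level v).
Proof.
rewrite /Q_level /= /join_fun; case: (@split n.+1 n.+1 v) => j.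
  by rewrite (@unsplitK m.+1 m.+1 (inl _)) /= rev_ordK.
by rewrite (@unsplitK m.+1 m.+1 (inr _)).
Qed.

Lemma Q_map_fix n (e : simp n n) (v : 'I_(Q n).+1) :
  e (Q_level v) = Q_level v -> df_map Q e v = v.
Proof.
move=> ev; rewrite -[RHS](@splitK n.+1 n.+1 v) /= /join_fun; move: ev.
by rewrite /Q_level; case: (@split n.+1 n.+1 v) => j /= ->; rewrite ?rev_ordK.
Qed.

Definition Q_fixes n (e : simp n n) k (x : Delta (Q n) k) : Prop :=
  simp_comp (df_map Q e) x = x.

(** The image of bF(n) under the left adjoint of Tw: the simplices whose
    vertices have levels in a proper subset of n.  The idempotent retraction
    onto such a subset is a fixing [e]. *)
Definition Tw_boundary n k (x : Delta (Q n) k) : Prop :=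
  exists2 e : simp n n, in_boundary (e : Delta n n) & Q_fixes e x.

Lemma Tw_boundary_act n k l (a : simp k l) (x : Delta (Q n) l) :
  Tw_boundary x -> Tw_boundary (ss_act a x).
Proof.
case=> e eb ex; exists e => //; rewrite /Q_fixes -[in RHS]ex.
exact: simp_ext.
Qed.

Lemma boundary_fixer n k (d : simp k n) : in_boundary (d : Delta n k) ->
  exists2 e : simp n n, in_boundary (e : Delta n n) & simp_comp e d = d.
Proof.
case=> j dj; have [r [rd rid]] := retraction_onto d.
exists r; first by exists j => v; have [t ->] := rd v; apply: dj.
exact: simp_ext.
Qed.

Lemma Q_fixes_map n k (e : simp n n) (d : simp k n) :
  simp_comp e d = d -> Q_fixes e (df_map Q d : Delta (Q n) (Q k)).
Proof. by move=> ed; rewrite /Q_fixes -df_comp ed. Qed.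

Lemma Tw_boundary_map n k (d : simp k n) :
  in_boundary (d : Delta n k) -> Tw_boundary (df_map Q d : Delta (Q n) (Q k)).
Proof.
by case/boundary_fixer=> e eb ed; exists e => //; apply: Q_fixes_map.
Qed.

(** * Transposing maps into the twisted arrow construction *)

Section TwExtension.

Variables (n : nat) (B : sSet) (W : sSpace).
Variable g : spMap (spProd (bF n) (spConst B)) (Tw W).

(** Both values agree with the one for a retraction [r] onto the levels of [x],
    because [e r = r = e' r]. *)
Lemma Tw_value_uniq k l (x : Delta (Q n) k) (b : B l) (e e' : bDelta n n) :
    Q_fixes (proj1_sig e) x -> Q_fixes (proj1_sig e') x ->
  sp_act x l (g n l (e, b)) = sp_act x l (g n l (e', b)).
Proof.
move=> ex e'x; have [r [rx rid]] := retraction_onto (fun t => Q_level (x t)).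
have rfix : Q_fixes r x by apply: simp_ext => t; apply: Q_map_fix; apply: rid.
have absorb (d : bDelta n n) : Q_fixes (proj1_sig d) x ->
    simp_comp (proj1_sig d) r = r.
  move=> dx; apply: simp_ext => v /=; have [t ->] := rx v.
  by rewrite -Q_level_map -[df_map _ _ _]/(simp_comp _ x t) dx.
(* As [x = Q r x], naturality of [g] moves [Q r] onto [d]. *)
have slide (d : bDelta n n) :
    sp_act x l (g n l (d, b)) = sp_act x l (g n l (ss_act r d, b)).
  rewrite -{1}rfix sp_comp; congr (sp_act x l _).
  exact: esym (spm_nat g r (d : bF n n l, b)).
rewrite (slide e) (slide e'); congr (sp_act x l (g n l (_, b))).
by apply: sSub_ext; rewrite /= !absorb.
Qed.

Definition Tw_fixer k (x : sSub (@Tw_boundary_act n) k) : bDelta n n :=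
  let: exist2 e eb _ := cid2 (proj2_sig x) in exist _ e eb.

Lemma Tw_fixerP k (x : sSub (@Tw_boundary_act n) k) :
  Q_fixes (proj1_sig (Tw_fixer x)) (proj1_sig x).
Proof. by rewrite /Tw_fixer; case: cid2. Qed.

Program Definition Tw_ext :
    spMap (spProd (spDisc (sSub (@Tw_boundary_act n))) (spConst B)) W :=
  @SpMap (spProd (spDisc (sSub (@Tw_boundary_act n))) (spConst B)) W
    (fun k => @SMap (spProd (spDisc (sSub (@Tw_boundary_act n))) (spConst B) k) (W k)
       (fun l xb => sp_act (proj1_sig xb.1) l (g n l (Tw_fixer xb.1, xb.2))) _) _.
Next Obligation.
by move=> k l m a [x b] /=; rewrite -sm_nat -(spMap_natl g).
Qed.
Next Obligation.
move=> k m a l [x b] /=; rewrite -sp_comp; apply: Tw_value_uniq.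
  exact: (Tw_fixerP (ss_act a x)).
by rewrite /Q_fixes -[in RHS](Tw_fixerP x); apply: simp_ext.
Qed.

End TwExtension.

Program Definition yoneda_ext n A (W : sSpace) (c : sMap A (W n)) :
    spMap (spProd (F n) (spConst A)) W :=
  @SpMap (spProd (F n) (spConst A)) W
    (fun k => @SMap (spProd (F n) (spConst A) k) (W k)
       (fun l xa => sp_act (xa.1 : simp k n) l (c l xa.2)) _) _.
Next Obligation. by move=> n A W c k l m a [x b] /=; rewrite !sm_nat. Qed.
Next Obligation. by move=> n A W c k m a l [x b] /=; rewrite sp_comp. Qed.

Program Definition Tw_restrict n B W (w : spMap (spProd (F (Q n)) (spConst B)) W) :
    spMap (spProd (F n) (spConst B)) (Tw W) :=
  @SpMap (spProd (F n) (spConst B)) (Tw W)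
    (fun k => @SMap (spProd (F n) (spConst B) k) (Tw W k)
       (fun l xb => w (Q k) l (df_map Q (xb.1 : simp k n), xb.2)) _) _.
Next Obligation. by move=> n B W w k l m a [x b] /=; rewrite -(spMap_natl w). Qed.
Next Obligation.
move=> n B W w k m a l [x b]; rewrite -[RHS](spm_nat w).
by congr (w (Q k) l (_, b)); apply: (df_comp Q).
Qed.

(** A map on F(n) x A is determined by its values at the identity of n, so it
    transposes to F(Q n) x A by the Yoneda lemma; on bF(n) x B the transpose is
    [Tw_ext].  A filler in W is transposed back by restriction along Q. *)
Lemma pp_ext_Tw n A B (i : sMap A B) W :
  pp_ext i (spDisc_map (sSub_incl (@Tw_boundary_act n))) W ->
  pp_ext i (bF_incl n) (Tw W).
Proof.
move=> ext f g fg.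
have c_nat l m (a : simp l m) x :
    f n l (simp_id n : F n n l, ss_act a x)
    = ss_act a (f n m (simp_id n : F n n m, x)).
  by rewrite -(spMap_natl f).
pose c : sMap A (W (Q n)) :=
  @SMap A (W (Q n)) (fun l a => f n l (simp_id n : F n n l, a)) c_nat.
have fE k l (d : simp k n) (a : A l) :
    f k l (d : F n k l, a) = sp_act (df_map Q d) l (c l a).
  rewrite -[RHS](spm_nat f d (simp_id n : F n n l, a)).
  by congr (f k l (_, a)); apply: simp_ext.
have [|w [wf wg]] := ext (yoneda_ext c) (Tw_ext g).
  move=> k l x a.
  transitivity (sp_act (proj1_sig x) l (f n l (proj1_sig (Tw_fixer x) : F n n l, a))).
    by rewrite fE -sp_comp Tw_fixerP.
  exact: (congr1 (sp_act (proj1_sig x : simp k (Q n)) l) (fg n l (Tw_fixer x) a)).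
exists (Tw_restrict w); split=> k l d b; first by rewrite /= wf fE.
pose x : sSub (@Tw_boundary_act n) (Q k) :=
  exist _ (df_map Q (proj1_sig d)) (Tw_boundary_map (proj2_sig d)).
transitivity (sp_act (proj1_sig x) l (g n l (Tw_fixer x, b))).
  exact: (wg (Q k) l x b).
have [e eb ed] := boundary_fixer (proj2_sig d).
rewrite (Tw_value_uniq g b (e' := exist _ e eb) (Tw_fixerP x) (Q_fixes_map ed)).
rewrite -[LHS](spm_nat g (proj1_sig d) (exist _ e eb : bF n n l, b)).
by congr (g k l (_, b)); apply: sSub_ext.
Qed.

Theorem corollary4p4 (W : sSpace) (hW : reedy_fibrant W) : reedy_fibrant (Tw W).
Proof.
move=> n m h; apply/rlp_Map_pre; apply: pp_ext_Tw; apply: pp_ext_sub => p.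
by apply/rlp_Map_pre; apply: hW.
Qed.
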